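(* Fix an observation $x$ and integers $M\ge 1$, $K\ge 1$. Let $p(x\mid z)$ be a likelihood, $p(z,\zeta)$ a joint density with $p(z)=\int p(z,\zeta)\,d\zeta$, and $p(x)=\int p(x\mid z)p(z)\,dz$. Let $q(z,\psi\mid x)=q(\psi\mid x)\,q(z\mid\psi,x)$ be a joint density with marginal $q(z\mid x)=\int q(z,\psi\mid x)\,d\psi$. Let $\tau(\psi\mid z,x)$ be a conditional density in $\psi$ such that $\tau(\psi\mid z,x)=0$ implies $q(z,\psi\mid x)=0$, and let $\rho(\zeta\mid z)$ be a conditional density in $\zeta$. Consider the generative process: (1) sample $\psi_{m,0}\sim q(\psi\mid x)$ for $1\le m\le M$; (2) sample $z_m\sim q(z\mid x,\psi_{m,0})$ for $1\le m\le M$; (3) sample $\psi_{m,k}\sim\tau(\psi\mid z_m,x)$ for $1\le m\le M$, $1\le k\le K$; (4) sample $\zeta_{m,k}\sim\rho(\zeta\mid z_m)$ for $1\le m\le M$, $1\le k\le K$ (all samples conditionally independent given what they condition on). Then $$\log p(x)\ge\mathbb{E}\log\left[\frac{1}{M}\sum_{m=1}^M\frac{p(x\mid z_m)\,\frac{1}{K}\sum_{k=1}^K\frac{p(z_m,\zeta_{m,k})}{\rho(\zeta_{m,k}\mid z_m)}}{\frac{1}{K+1}\sum_{k=0}^K\frac{q(z_m,\psi_{m,k}\mid x)}{\tau(\psi_{m,k}\mid z_m,x)}}\right],$$ where the expectation is over the generative process above.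
   Context: All densities are with respect to fixed base measures; $\log$ is the natural logarithm. *)

(* Defs.v *)
From HB Require Import structures.
From mathcomp Require Import all_boot all_order all_algebra.
From mathcomp Require Import all_classical all_reals all_analysis.
Set Implicit Arguments. Unset Strict Implicit. Unset Printing Implicit Defensive.
Import Order.TTheory GRing.Theory Num.Theory.
Import numFieldNormedType.Exports.
Local Open Scope classical_set_scope.
Local Open Scope ring_scope.
Local Open Scope ereal_scope.

Local Unset Implicit Arguments.
Fixpoint tuple_measure d (T : measurableType d) (R : realType)
    (mu : set T -> \bar R) (n : nat) : set (n.-tuple T) -> \bar R :=
  match n with
  | 0 => fun A => (\1_A [tuple] )%:E
  | n'.+1 => fun A =>
      \int[mu]_x tuple_measure d T R mu n' [set t | A (cons_tuple x t)]
  end.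
Arguments tuple_measure {d T R} mu n.

(* Main.v *)
(** By Jensen it suffices that the importance-weighted average [W] satisfies
    [E W <= p(x)]; this is used through the tangent bound
    [log W <= log a - 1 + W / a], valid for every [a > 0].  The blocks being
    i.i.d., the bound reduces to a single block.  There, integrating out the
    [zeta_k] turns the numerator into at most [p(x | z) p(z)].  For the
    denominator, put [w = q(z, psi | x) / tau(psi | z, x)]: since
    [q(z, psi_0 | x) = w(psi_0) tau(psi_0 | z, x)], the variables
    [psi_0, ..., psi_K] become exchangeable with density [prod_k tau(psi_k)],
    so the integral of [(K + 1) w(psi_0) / sum_k w(psi_k)] equals that of
    [sum_j w(psi_j) / sum_k w(psi_k)], which is at most 1. *)

Require Import Defs.
From HB Require Import structures.
From mathcomp Require Import all_boot all_order all_algebra.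
From mathcomp Require Import all_classical all_reals all_analysis.
From mathcomp Require Import measurable_realfun ring.
Import Order.TTheory GRing.Theory Num.Theory.
Import numFieldNormedType.Exports.
Local Open Scope classical_set_scope.
Local Open Scope ring_scope.

(** * Monotonicity of the integral and Jensen's inequality for [lne] *)

Section integral_complements.
Context d (T : measurableType d) (R : realType).
Local Open Scope ereal_scope.

Import HBNNSimple.

(** The integral is a difference of suprema over simple functions lying below the positive and the
    negative part; the first supremum grows with the integrand and the second shrinks, for arbitrary
    functions. *)
Lemma le_integral_pointwise (mu : set T -> \bar R) (f g : T -> \bar R) :
  (forall x, f x <= g x) -> \int[mu]_x f x <= \int[mu]_x g x.
Proof.
move=> fg; rewrite /integral !patch_setT; apply: leeB.
- apply: ereal_sup_le => _ [h hf <-]; exists h => // x.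
  apply: (le_trans (hf x)).
  rewrite !funeposE.
  by case: (leP (f x) 0) => f0; rewrite le_max ?lexx ?orbT// fg.
- apply: ereal_sup_le => _ [h hf <-]; exists h => // x.
  apply: (le_trans (hf x)).
  rewrite !funenegE ge_max !le_max lexx orbT andbT.
  by rewrite leeN2 fg.
Qed.

(** Integrating the tangent bound at [a] gives one upper bound for each [a > 0]; the best one, at
    [a = c], is [lne c] when [c] is finite and positive. The other values of [c] are treated
    apart. *)
Lemma integral_density_lne_le (mu : {measure set T -> \bar R}) (D W : T -> R)
    (c : \bar R) :
  measurable_fun setT D -> measurable_fun setT W ->
  (forall x, 0 <= D x)%R -> (forall x, 0 <= W x)%R ->
  \int[mu]_x (D x)%:E = 1 -> \int[mu]_x (D x * W x)%:E <= c ->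
  \int[mu]_x ((D x)%:E * lne (W x)%:E) <= lne c.
Proof.
move=> mD mW D0 W0 intD intDW.
have [->|cfin] := eqVneq c +oo; first by rewrite leey.
have iD : mu.-integrable setT (EFin \o D).
  apply/integrableP; split; first exact/measurable_EFinP.
  by under eq_integral do rewrite /= ger0_norm//; rewrite intD ltry.
have iDW : mu.-integrable setT (fun x => (D x * W x)%:E).
  apply/integrableP; split; first exact/measurable_EFinP/measurable_funM.
  under eq_integral do rewrite /= ger0_norm ?mulr_ge0//.
  by rewrite (le_lt_trans intDW)// ltey.
have key (a : R) : (0 < a)%R ->
    \int[mu]_x ((D x)%:E * lne (W x)%:E) <= (ln a - 1)%:E + a^-1%:E * c.
  move=> a0; apply: (@le_trans _ _ (\int[mu]_x
      ((ln a - 1)%:E * (D x)%:E + a^-1%:E * (D x * W x)%:E))).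
    apply: le_integral_pointwise => x.
    (* Where [D] vanishes both sides are 0, since [0 * -oo = 0]; where only [W] vanishes the left
       side is [-oo]. The tangent bound is thus needed for positive values only. *)
    have [->|Dx] := eqVneq (D x) 0%R; first
      by rewrite !(mul0e,mule0,mul0r) adde0.
    have {}Dx : (0 < D x)%R by rewrite lt_neqAle eq_sym Dx D0.
    have [->|Wx] := eqVneq (W x) 0%R.
      by rewrite le0_lneNy// gt0_muleNy ?lte_fin// leNye.
    have {}Wx : (0 < W x)%R by rewrite lt_neqAle eq_sym Wx W0.
    rewrite lne_EFin// -!EFinM -EFinD lee_fin.
    have -> : ((ln a - 1) * D x + a^-1 * (D x * W x) =
               D x * (ln a + (W x / a - 1)))%R by ring.
    rewrite ler_pM2l// -lerBlDl -ln_div ?posrE//.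
    rewrite -[X in ln X](subrK 1%R) addrC le_ln1Dx//.
    by rewrite ltrBrDr addNr divr_gt0.
  rewrite integralD//; [|exact: integrableZl|exact: integrableZl].
  rewrite !integralZl// intD mule1 leeD2l// lee_pmul2l// ?lte_fin ?invr_gt0//.
move: c cfin intDW key => [r| |]//= _ intDW key; last first.
  have := key 1%R ltr01; rewrite invr1 mul1e.
  by rewrite addeNy.
(* [lne] is [-oo] at [r <= 0]; for [r > 0] the bound at [a = r] equals [ln r]. *)
case: ifPn => [r0|]; last first.
  rewrite -ltNge => r0; apply: (le_trans (key _ r0)).
  by rewrite -EFinM -EFinD lee_fin mulVf ?gt_eqF// subrK.
have {}r0 : r = 0%R.
  apply/eqP; rewrite eq_le r0 -lee_fin (le_trans _ intDW)//.
  by apply: integral_ge0 => x _; rewrite lee_fin mulr_ge0.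
(* For [c = 0] the integral must be [-oo]: a finite value [i] would satisfy [i <= i - 1] by the
   bound at [a = expR i]. *)
move: key; rewrite r0; set I := integral _ _ _; case: I => [i| |] key.
- have := key _ (expR_gt0 i); rewrite expRK mule0 adde0 lee_fin.
  by rewrite lerBrDr gerDl ler10.
- by have := key _ ltr01; rewrite mule0 adde0.
- by [].
Qed.

End integral_complements.

(** * Measurable division and sigma-finite product measures *)

Lemma measurable_invr (R : realType) : measurable_fun setT (@GRing.inv R).
Proof.
rewrite -(setvU [set 0%R]); apply/measurable_funU => //.
  exact: measurableC.
split; last exact: measurable_fun_set1.
apply: open_continuous_measurable_fun.
  by rewrite openC; apply: accessible_closed_set1; apply: hausdorff_accessible.
by move=> x; rewrite inE => /eqP; exact: inv_continuous.
Qed.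

Lemma measurable_fun_divr d (T : measurableType d) (R : realType)
    (f g : T -> R) : measurable_fun setT f -> measurable_fun setT g ->
  measurable_fun setT (fun x => f x / g x).
Proof.
move=> mf mg; apply: measurable_funM => //.
exact: (measurableT_comp (measurable_invr R) mg).
Qed.

(* [product_measure1] carries a canonical sigma-finite structure only for
   factors that are subprobabilities; this copy carries one for arbitrary
   sigma-finite factors. *)
Definition sfprod d1 d2 (T1 : measurableType d1) (T2 : measurableType d2)
    (R : realType) (m1 : {sigma_finite_measure set T1 -> \bar R})
    (m2 : {sigma_finite_measure set T2 -> \bar R}) :
    set (T1 * T2) -> \bar R := (m1 \x m2)%E.
Arguments sfprod {d1 d2 T1 T2 R} m1 m2.

Section sfprod_theory.
Context d1 d2 (T1 : measurableType d1) (T2 : measurableType d2) (R : realType).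
Local Open Scope ereal_scope.
Variables (m1 : {sigma_finite_measure set T1 -> \bar R})
  (m2 : {sigma_finite_measure set T2 -> \bar R}).

HB.instance Definition _ := isMeasure.Build _ _ _ (sfprod m1 m2)
  (measure0 (m1 \x m2)) (measure_ge0 (m1 \x m2))
  (@measure_semi_sigma_additive _ _ _ (m1 \x m2)).

Let sfprod_sigma_finite : sigma_finite setT (sfprod m1 m2).
Proof.
have /sigma_finiteP[F [TF ndF Foo]] := sigma_finiteT m1.
have /sigma_finiteP[G [TG ndG Goo]] := sigma_finiteT m2.
(* Both exhaustions are nondecreasing, so the diagonal rectangles already cover the product. *)
exists (fun n => F n `*` G n).
  apply/esym/seteqP; split => // -[x y] _.
  have [i _ Fx] : (\bigcup_i F i) x by rewrite -TF.
  have [j _ Gy] : (\bigcup_i G i) y by rewrite -TG.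
  exists (maxn i j) => //; split.
  - exact: (subsetPset _ _ (ndF _ _ (leq_maxl i j))).
  - exact: (subsetPset _ _ (ndG _ _ (leq_maxr i j))).
move=> k; have [mF Fk] := Foo k; have [mG Gk] := Goo k; split.
  exact: measurableX.
rewrite /sfprod product_measure1E// lte_mul_pinfty// ge0_fin_numE//.
Qed.

HB.instance Definition _ := Measure_isSigmaFinite.Build _ _ _ (sfprod m1 m2)
  sfprod_sigma_finite.

Variable f : T1 * T2 -> \bar R.
Hypotheses (f0 : forall u, 0 <= f u) (mf : measurable_fun setT f).

Lemma integral_sfprod1 :
  \int[sfprod m1 m2]_u f u = \int[m1]_x \int[m2]_y f (x, y).
Proof. exact: fubini_tonelli1. Qed.

Lemma integral_sfprod2 :
  \int[sfprod m1 m2]_u f u = \int[m2]_y \int[m1]_x f (x, y).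
Proof. exact: fubini_tonelli2. Qed.

End sfprod_theory.

Local Arguments tuple_measure {d T R} mu n : simpl never.

(** * Tuple measures as sigma-finite measures, and their iterated integrals *)

Section cons_measure.
Context d (T : measurableType d) (R : realType) (n : nat).
Local Open Scope ereal_scope.

Definition cons_pair (u : T * n.-tuple T) : n.+1.-tuple T :=
  cons_tuple u.1 u.2.

Lemma measurable_cons_pair : measurable_fun setT cons_pair.
Proof. exact: measurable_cons. Qed.

Variables (mu : {sigma_finite_measure set T -> \bar R})
  (m : {sigma_finite_measure set (n.-tuple T) -> \bar R}).

Let mum : {sigma_finite_measure set (T * n.-tuple T)%type -> \bar R} :=
  sfprod mu m.

(* The measure structure of a pushforward depends on a measurability proof that
   is not inferred, hence the explicit structure. *)
Let mcons : {measure set (n.+1.-tuple T) -> \bar R} :=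
  measure_function_pushforward__canonical__measure_function_Measure mum
    measurable_cons_pair.

Definition cons_measure : set (n.+1.-tuple T) -> \bar R := mcons.

HB.instance Definition _ := Measure.on cons_measure.

Let cons_measure_sigma_finite : sigma_finite setT cons_measure.
Proof.
have [F UF mF] := sigma_finiteT mum.
(* [ht] is the measurable inverse of [cons_pair]; it carries an exhaustion of the product over to
   tuples. *)
pose ht (t : n.+1.-tuple T) := (thead t, behead_tuple t).
exists (fun i => ht @^-1` F i); first by rewrite -preimage_bigcup -UF.
move=> i; have [mFi Fi] := mF i; split.
  rewrite -[X in measurable X]setTI; apply: measurable_fun_pair => //.
    exact: measurable_tnth.
  exact: measurable_behead.
rewrite /cons_measure/= /pushforward [X in _ X < _](_ : _ = F i)//.
have htK u : ht (cons_pair u) = u.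
  by case: u => x t; congr pair; exact: val_inj.
by apply/seteqP; split => u /=; rewrite htK.
Qed.

HB.instance Definition _ := Measure_isSigmaFinite.Build _ _ _ cons_measure
  cons_measure_sigma_finite.

End cons_measure.

Section tuple_measure_theory.
Context d (T : measurableType d) (R : realType).
Local Open Scope ereal_scope.
Variable mu : {sigma_finite_measure set T -> \bar R}.

(** The recursive clause is the section formula for a product measure, which gives access to
    Tonelli's theorem. *)
Let tuple_measureS n :
  tuple_measure mu n.+1 =
  pushforward (mu \x tuple_measure mu n) (@cons_pair _ T n).
Proof.
apply/funext => A; apply: eq_integral => x _ /=; congr (tuple_measure mu n _).
by apply/seteqP; split => t; rewrite /xsection/= inE.
Qed.

(** The measure axioms at [n.+1] require a sigma-finite measure at [n], so a whole structure is
    carried through the induction; the axioms are then read off from it by rewriting. *)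
Let tuple_measureP n :
  exists m : {sigma_finite_measure set (n.-tuple T) -> \bar R},
    tuple_measure mu n = m.
Proof.
elim: n => [|n [m mE]]; first by exists (dirac [tuple]).
by exists (cons_measure _ _ _ _ mu m); rewrite tuple_measureS mE.
Qed.

Section instances.
Variable n : nat.

Let tuple_measure0 : tuple_measure mu n set0 = 0.
Proof. by have [m ->] := tuple_measureP n; rewrite measure0. Qed.

Let tuple_measure_ge0 A : 0 <= tuple_measure mu n A.
Proof. by have [m ->] := tuple_measureP n; exact: measure_ge0. Qed.

Let tuple_measure_additive : semi_sigma_additive (tuple_measure mu n).
Proof.
have [m ->] := tuple_measureP n; exact: measure_semi_sigma_additive.
Qed.

HB.instance Definition _ := isMeasure.Build _ _ _ (tuple_measure mu n)
  tuple_measure0 tuple_measure_ge0 tuple_measure_additive.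

Let tuple_measure_sigma_finite : sigma_finite setT (tuple_measure mu n).
Proof. by have [m ->] := tuple_measureP n; exact: sigma_finiteT. Qed.

HB.instance Definition _ := Measure_isSigmaFinite.Build _ _ _
  (tuple_measure mu n) tuple_measure_sigma_finite.

End instances.

Lemma integral_tuple_measure0 (f : 0.-tuple T -> \bar R) :
  measurable_fun setT f ->
  \int[tuple_measure mu 0]_t f t = f [tuple].
Proof.
move=> mf; have -> : tuple_measure mu 0 = dirac [tuple] by [].
by rewrite integral_dirac// diracT mul1e.
Qed.

Lemma integral_tuple_measureS n (f : n.+1.-tuple T -> \bar R) :
  (forall t, 0 <= f t) -> measurable_fun setT f ->
  \int[tuple_measure mu n.+1]_t f t =
  \int[mu]_x \int[tuple_measure mu n]_t f (cons_tuple x t).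
Proof.
move=> f0 mf; rewrite tuple_measureS.
rewrite (ge0_integral_pushforward (@measurable_cons_pair _ T n)
  (sfprod mu (tuple_measure mu n)))//.
rewrite integral_sfprod1 => [//|u|]; first exact: f0.
exact: (measurableT_comp mf (@measurable_cons_pair _ T n)).
Qed.

End tuple_measure_theory.

(** * Measurability of tuple sums, tuple products and partial integrals *)

Section measurability.
Context d (T : measurableType d) (R : realType).

Lemma measurable_tuple_sum n (w : T -> R) : measurable_fun setT w ->
  measurable_fun setT (fun t : n.-tuple T => \sum_(x <- t) w x).
Proof.
move=> mw; under eq_fun do rewrite big_tuple.
apply: measurable_sum => i.
by apply: measurableT_comp => //; exact: measurable_tnth.
Qed.

Lemma measurable_tuple_prod n (w : T -> R) : measurable_fun setT w ->
  measurable_fun setT (fun t : n.-tuple T => \prod_(x <- t) w x).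
Proof.
move=> mw; under eq_fun do rewrite big_tuple.
apply: measurable_prod => i _.
by apply: measurableT_comp => //; exact: measurable_tnth.
Qed.

Lemma measurable_integral_snd d' (T' : measurableType d')
    (m : {sigma_finite_measure set T' -> \bar R}) (f : T * T' -> R) :
  (forall u, 0 <= f u) -> measurable_fun setT f ->
  measurable_fun setT (fun x => \int[m]_y (f (x, y))%:E)%E.
Proof.
move=> f0 mf.
apply: (@measurable_fun_fubini_tonelli_F _ _ _ _ _ m (EFin \o f)).
- exact/measurable_EFinP.
- by move=> u; rewrite /= lee_fin.
Qed.

End measurability.

(** * Symmetrization under tuple measures *)

Section symmetric_functions.
Context d (T : measurableType d) (R : realType).
Local Open Scope ereal_scope.
Variable mu : {sigma_finite_measure set T -> \bar R}.

(* Induction on [n]: the terms of the sum other than the first are handled by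
   the hypothesis applied to [fun s => G (x :: s)], and exchanging the first two
   variables turns each of them into the first term. *)
Lemma integral_sum_symmetric n (w : T -> R) (G : seq T -> R) :
  (forall x, 0 <= w x)%R -> measurable_fun setT w ->
  (forall s, 0 <= G s)%R ->
  (forall k, measurable_fun setT (fun t : k.-tuple T => G t)) ->
  (forall s t, perm_eq s t -> G s = G t) ->
  \int[tuple_measure mu n.+1]_t ((\sum_(x <- t) w x) * G t)%:E =
  n.+1%:R%:E * \int[mu]_x \int[tuple_measure mu n]_t (w x * G (x :: t))%:E.
Proof.
move=> w0 mw.
have mcons k : measurable_fun setT
    (fun u : T * k.-tuple T => cons_tuple u.1 u.2).
  exact: measurable_cons_pair.
have mSG (H : seq T -> R) k : measurable_fun setT (fun t : k.-tuple T => H t) ->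
    measurable_fun setT (fun t : k.-tuple T => ((\sum_(x <- t) w x) * H t)%:E).
  move=> mH; apply/measurable_EFinP/measurable_funM => //.
  exact: measurable_tuple_sum.
elim: n G => [|n IH] G G0 mG symG.
  rewrite mul1e integral_tuple_measureS; first last.
  - exact: mSG.
  - by move=> t; rewrite lee_fin mulr_ge0// sumr_ge0.
  apply: eq_integral => x _; apply: eq_integral => t _ /=.
  by rewrite big_cons tuple0 big_nil addr0.
have mwG k : measurable_fun setT
    (fun u : T * k.-tuple T => w u.1 * G (u.1 :: u.2))%R.
  apply: measurable_funM; first exact: measurableT_comp.
  exact: (measurableT_comp (mG k.+1) (mcons k)).
have m1G x k : measurable_fun setT (fun t : k.-tuple T => G (x :: t)).
  by apply: (measurableT_comp (mG k.+1)); exact: measurable_cons.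
set A := \int[mu]_x _.
have int_tl x : \int[tuple_measure mu n.+1]_t
      ((\sum_(y <- t) w y) * G (x :: t))%:E =
    n.+1%:R%:E * \int[mu]_y
      \int[tuple_measure mu n]_t (w y * G (x :: y :: t))%:E.
  apply: (IH (fun s => G (x :: s))) => // s t st.
  by apply: symG; rewrite perm_cons.
have mH : measurable_fun setT (fun u : T * T =>
    \int[tuple_measure mu n]_t (w u.2 * G (u.1 :: u.2 :: t))%:E).
  apply: (@measurable_integral_snd _ _ _ _ _ (tuple_measure mu n)
    (fun v : (T * T) * n.-tuple T => w v.1.2 * G (v.1.1 :: v.1.2 :: v.2)))%R.
    by move=> u; rewrite mulr_ge0.
  apply: measurable_funM.
    by apply: measurableT_comp => //; exact: measurableT_comp.
  apply: (measurableT_comp (mG n.+2)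
    (g := fun v : (T * T) * n.-tuple T =>
      cons_tuple v.1.1 (cons_tuple v.1.2 v.2))).
  apply: measurable_cons; first exact: measurableT_comp.
  by apply: measurable_cons => //; exact: measurableT_comp.
have H0 (u : T * T) :
    0 <= \int[tuple_measure mu n]_t (w u.2 * G (u.1 :: u.2 :: t))%:E.
  by apply: integral_ge0 => t _; rewrite lee_fin mulr_ge0.
(* Tonelli exchanges the first two variables, and the symmetry of [G] restores their order in its
   argument, so the weight falls on the outer variable as in [A]. *)
have swapA : \int[mu]_x \int[mu]_y
    \int[tuple_measure mu n]_t (w y * G (x :: y :: t))%:E = A.
  rewrite (fubini_tonelli (fun u : T * T =>
    \int[tuple_measure mu n]_t (w u.2 * G (u.1 :: u.2 :: t))%:E))//=.
  apply: eq_integral => y _; rewrite integral_tuple_measureS; first last.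
  - by apply/measurable_EFinP/measurable_funM => //; exact: m1G.
  - by move=> t; rewrite lee_fin mulr_ge0.
  apply: eq_integral => x _; apply: eq_integral => t _ /=.
  congr (w y * _)%:E; apply: symG.
  exact/permPl/(perm_catCA [:: x] [:: y]).
rewrite integral_tuple_measureS; first last.
- exact: mSG.
- by move=> t; rewrite lee_fin mulr_ge0// sumr_ge0.
(* The head of the sum contributes [A] and its tail, by [int_tl] and [swapA], [n.+1] copies of
   [A]. *)
transitivity (\int[mu]_x (
    \int[tuple_measure mu n.+1]_t (w x * G (x :: t))%:E +
    n.+1%:R%:E * \int[mu]_y
      \int[tuple_measure mu n]_t (w y * G (x :: y :: t))%:E)).
  apply: eq_integral => x _; rewrite -int_tl -ge0_integralD//=.
  - by apply: eq_integral => t _; rewrite /= big_cons mulrDl EFinD.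
  - by move=> t _; rewrite lee_fin mulr_ge0.
  - by apply/measurable_EFinP/measurable_funM => //; exact: m1G.
  - by move=> t _; rewrite lee_fin mulr_ge0// sumr_ge0.
  - exact: (mSG (fun s => G (x :: s))).
have mH1 : measurable_fun setT (fun x => \int[mu]_y
    \int[tuple_measure mu n]_t (w y * G (x :: y :: t))%:E).
  exact: (measurable_fun_fubini_tonelli_F _ mH H0).
have H10 x : 0 <= \int[mu]_y
    \int[tuple_measure mu n]_t (w y * G (x :: y :: t))%:E.
  by apply: integral_ge0 => y _; exact: (H0 (x, y)).
rewrite ge0_integralD//=.
- rewrite ge0_integralZl// swapA -/A.
  by rewrite -[X in X + _]mul1e -ge0_muleDl// -EFinD -natr1 addrC.
- by move=> x _; apply: integral_ge0 => t _; rewrite lee_fin mulr_ge0.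
- apply: (@measurable_integral_snd _ _ _ _ _ (tuple_measure mu n.+1)
    (fun u : T * n.+1.-tuple T => w u.1 * G (u.1 :: u.2))%R).
    by move=> u; rewrite mulr_ge0.
  exact: mwG.
- by move=> x _; rewrite mule_ge0.
- exact: measurable_funeM.
Qed.

Section product_density.
Variable g : T -> R.
Hypotheses (g0 : forall x, (0 <= g x)%R) (mg : measurable_fun setT g)
  (int_g : \int[mu]_x (g x)%:E = 1).

Lemma integral_tuple_prod n :
  \int[tuple_measure mu n]_t (\prod_(x <- t) g x)%:E = 1.
Proof.
elim: n => [|n IH].
  rewrite integral_tuple_measure0; first by rewrite big_nil.
  by apply/measurable_EFinP; exact: measurable_tuple_prod.
rewrite integral_tuple_measureS; first last.
- by apply/measurable_EFinP; exact: measurable_tuple_prod.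
- by move=> t; rewrite lee_fin prodr_ge0.
rewrite -[RHS]int_g; apply: eq_integral => x _.
under eq_integral do rewrite /= big_cons EFinM.
rewrite ge0_integralZl ?IH ?mule1//.
- by apply/measurable_EFinP; exact: measurable_tuple_prod.
- by move=> t _; rewrite lee_fin prodr_ge0.
- by rewrite lee_fin.
Qed.

(** By symmetry all [n] summands have the same integral, in which the factors [g] at the other
    entries integrate to 1. This serves both the average over the [zeta_k] and the average over the
    [M] blocks. *)
Lemma integral_tuple_sum_prod n (w : T -> R) :
  (forall x, 0 <= w x)%R -> measurable_fun setT w ->
  \int[tuple_measure mu n]_t ((\sum_(x <- t) w x) * \prod_(x <- t) g x)%:E =
  n%:R%:E * \int[mu]_x (w x * g x)%:E.
Proof.
move=> w0 mw; case: n => [|n].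
  rewrite mul0e; apply: integral0_eq => t _.
  by rewrite tuple0 big_nil mul0r.
rewrite (integral_sum_symmetric n w (fun s => \prod_(x <- s) g x)%R)//.
- congr (_ * _); apply: eq_integral => x _.
  under eq_integral do rewrite /= big_cons mulrA EFinM.
  rewrite ge0_integralZl ?integral_tuple_prod ?mule1//.
  + by apply/measurable_EFinP; exact: measurable_tuple_prod.
  + by move=> t _; rewrite lee_fin prodr_ge0.
  + by rewrite lee_fin mulr_ge0.
- by move=> s; rewrite prodr_ge0.
- by move=> k; exact: measurable_tuple_prod.
- by move=> s t st; exact: perm_big.
Qed.

End product_density.

End symmetric_functions.

(** * Importance-weighted averages in the numerator and the denominator *)

Section importance_weights.
Context d (T : measurableType d) (R : realType).
Local Open Scope ereal_scope.
Variable mu : {sigma_finite_measure set T -> \bar R}.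
Variables (K : nat) (q t : T -> R).
Hypotheses (q0 : forall x, (0 <= q x)%R) (mq : measurable_fun setT q)
  (t0 : forall x, (0 <= t x)%R) (mt : measurable_fun setT t)
  (int_t : \int[mu]_x (t x)%:E = 1).

Let w x : R := (q x / t x)%R.

Let w0 x : (0 <= w x)%R. Proof. by rewrite divr_ge0. Qed.

Let mw : measurable_fun setT w.
Proof. exact: measurable_fun_divr. Qed.

(** Each weight integrates against [t] to the mass of [q] on the set where [t] is nonzero. Mass of
    [q] on the zeros of [t] is lost, since division by 0 gives 0; hence an inequality. *)
Lemma integral_mean_weight_le : (0 < K)%N ->
  \int[tuple_measure mu K]_s
    (\prod_(k < K) t (tnth s k) *
     (K%:R^-1 * \sum_(k < K) q (tnth s k) / t (tnth s k)))%:E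
  <= \int[mu]_x (q x)%:E.
Proof.
move=> K0.
under eq_integral => s _.
  rewrite -(big_tuple _ _ s xpredT t) -(big_tuple _ _ s xpredT w).
  rewrite mulrC -mulrA EFinM; over.
rewrite ge0_integralZl//; first last.
- by move=> s _; rewrite lee_fin mulr_ge0 ?sumr_ge0 ?prodr_ge0.
- apply/measurable_EFinP/measurable_funM; first exact: measurable_tuple_sum.
  exact: measurable_tuple_prod.
rewrite integral_tuple_sum_prod// muleA -EFinM mulVf ?pnatr_eq0 -?lt0n// mul1e.
apply: le_integral_pointwise => x; rewrite lee_fin /w.
by have [->|tx] := eqVneq (t x) 0%R; rewrite ?mulr0// divfK.
Qed.

Lemma integral_self_normalized_le :
  (forall x, t x = 0%R -> q x = 0%R) ->
  \int[mu]_x \int[tuple_measure mu K]_s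
    (q x * \prod_(k < K) t (tnth s k) /
     (K.+1%:R^-1 * (q x / t x + \sum_(k < K) q (tnth s k) / t (tnth s k))))%:E
  <= 1.
Proof.
move=> qt.
pose G (s : seq T) : R :=
  (\prod_(x <- s) t x / (K.+1%:R^-1 * \sum_(x <- s) w x))%R.
have G0 s : (0 <= G s)%R.
  by rewrite divr_ge0 ?prodr_ge0 ?mulr_ge0 ?invr_ge0 ?sumr_ge0.
have mG k : measurable_fun setT (fun s : k.-tuple T => G s).
  apply: measurable_fun_divr; first exact: measurable_tuple_prod.
  by apply: measurable_funM => //; exact: measurable_tuple_sum.
have symG s u : perm_eq s u -> G s = G u.
  by move=> su; congr (_ / (_ * _))%R; exact: perm_big.
(* The support condition gives [q x = w x * t x], so the first sample joins the symmetric product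
   inside [G]. *)
have GE x (s : K.-tuple T) : (q x * \prod_(k < K) t (tnth s k) /
     (K.+1%:R^-1 * (q x / t x + \sum_(k < K) q (tnth s k) / t (tnth s k))) =
     w x * G (x :: s))%R.
  rewrite /G !big_cons -(big_tuple _ _ s xpredT t) -(big_tuple _ _ s xpredT w).
  rewrite !mulrA; congr (_ * _ / _)%R.
  rewrite /w; have [tx|tx] := eqVneq (t x) 0%R; last by rewrite divfK.
  by rewrite tx mulr0 qt.
under eq_integral => x _ do under eq_integral => s _ do rewrite GE.
(* After multiplication by [K.+1], symmetrization replaces [w x] by the full sum of weights. The
   right side is written as [K.+1] times the integral of the product density, so that the integrands
   can be compared pointwise. *)
rewrite -(@lee_pmul2l _ K.+1%:R%:E) ?fin_numE ?lte_fin ?ltr0n//.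
rewrite -(integral_sum_symmetric _ _ _ mu K w G)//.
rewrite -(integral_tuple_prod _ _ _ mu t t0 mt int_t K.+1).
rewrite -ge0_integralZl//; first last.
- by move=> s _; rewrite lee_fin prodr_ge0.
- by apply/measurable_EFinP; exact: measurable_tuple_prod.
apply: le_integral_pointwise => s; rewrite -EFinM lee_fin /G.
set S := (\sum_(x <- s) w x)%R; set P := (\prod_(x <- s) t x)%R.
have P0 : (0 <= P)%R by rewrite prodr_ge0.
(* Where all weights cancel out to [S = 0] the left side is 0; elsewhere equality holds. *)
have [->|S0] := eqVneq S 0%R; first by rewrite mul0r mulr_ge0.
have -> : (S * (P / (K.+1%:R^-1 * S)) = K.+1%:R * P * (S / S))%R.
  by rewrite invfM invrK; ring.
by rewrite divff// mulr1.
Qed.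

End importance_weights.

(** * Measurability of sums and products over tuple entries with a parameter *)

Section measurable_tnth_big.
Context dX dY d (X : measurableType dX) (Y : measurableType dY)
  (T : measurableType d) (R : realType) (n : nat).
Variables (f : Y -> T -> R) (h : X -> Y) (s : X -> n.-tuple T).
Hypotheses (mf : measurable_fun setT (fun u : Y * T => f u.1 u.2))
  (mh : measurable_fun setT h) (ms : measurable_fun setT s).

Let mfk k : measurable_fun setT (fun x => f (h x) (tnth (s x) k)).
Proof.
apply: (measurableT_comp mf (g := fun x => (h x, tnth (s x) k))).
apply: measurable_fun_pair => //.
exact: (measurableT_comp (@measurable_tnth _ T n k) ms).
Qed.

Lemma measurable_sum_tnth :
  measurable_fun setT (fun x => \sum_(k < n) f (h x) (tnth (s x) k)).
Proof. exact: measurable_sum. Qed.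

Lemma measurable_prod_tnth :
  measurable_fun setT (fun x => \prod_(k < n) f (h x) (tnth (s x) k)).
Proof. exact: measurable_prod. Qed.

End measurable_tnth_big.

(** * Total mass and expected weight of a single block *)

Section block.
Context (R : realType) (dZ dP dE : measure_display)
  (Z : measurableType dZ) (Psi : measurableType dP) (Zeta : measurableType dE)
  (muZ : {sigma_finite_measure set Z -> \bar R})
  (muP : {sigma_finite_measure set Psi -> \bar R})
  (muE : {sigma_finite_measure set Zeta -> \bar R})
  (K : nat) (lik : Z -> R) (pj : Z -> Zeta -> R) (qpsi : Psi -> R)
  (qz : Psi -> Z -> R) (tau : Z -> Psi -> R) (rho : Z -> Zeta -> R).

(* A block is [((psi_0, z), ((psi_k)_{k<K}, (zeta_k)_{k<K}))]. *)
Definition block_measure : {sigma_finite_measure set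
    ((Psi * Z) * (K.-tuple Psi * K.-tuple Zeta))%type -> \bar R} :=
  sfprod (sfprod muP muZ) (sfprod (tuple_measure muP K) (tuple_measure muE K)).

Definition block_density (b : (Psi * Z) * (K.-tuple Psi * K.-tuple Zeta)) : R :=
  qpsi b.1.1 * qz b.1.1 b.1.2
  * (\prod_(k < K) tau b.1.2 (tnth b.2.1 k))
  * (\prod_(k < K) rho b.1.2 (tnth b.2.2 k)).

Definition block_weight (b : (Psi * Z) * (K.-tuple Psi * K.-tuple Zeta)) : R :=
  (lik b.1.2 * (K%:R^-1 * \sum_(k < K)
     pj b.1.2 (tnth b.2.2 k) / rho b.1.2 (tnth b.2.2 k)))
  / ((K.+1)%:R^-1 * (qpsi b.1.1 * qz b.1.1 b.1.2 / tau b.1.2 b.1.1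
     + \sum_(k < K) qpsi (tnth b.2.1 k) * qz (tnth b.2.1 k) b.1.2
                    / tau b.1.2 (tnth b.2.1 k))).

Hypotheses (lik0 : forall z, 0 <= lik z) (mlik : measurable_fun setT lik)
  (pj0 : forall z e, 0 <= pj z e)
  (mpj : measurable_fun setT (fun u : Z * Zeta => pj u.1 u.2))
  (qpsi0 : forall p, 0 <= qpsi p) (mqpsi : measurable_fun setT qpsi)
  (int_qpsi : (\int[muP]_p (qpsi p)%:E = 1)%E)
  (qz0 : forall p z, 0 <= qz p z)
  (mqz : measurable_fun setT (fun u : Psi * Z => qz u.1 u.2))
  (int_qz : forall p, (\int[muZ]_z (qz p z)%:E = 1)%E)
  (tau0 : forall z p, 0 <= tau z p)
  (mtau : measurable_fun setT (fun u : Z * Psi => tau u.1 u.2))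
  (int_tau : forall z, (\int[muP]_p (tau z p)%:E = 1)%E)
  (rho0 : forall z e, 0 <= rho z e)
  (mrho : measurable_fun setT (fun u : Z * Zeta => rho u.1 u.2))
  (int_rho : forall z, (\int[muE]_e (rho z e)%:E = 1)%E).

Lemma block_density_ge0 b : 0 <= block_density b.
Proof. by rewrite /block_density !mulr_ge0// prodr_ge0. Qed.

Lemma block_weight_ge0 b : 0 <= block_weight b.
Proof.
rewrite /block_weight divr_ge0// !mulr_ge0 ?invr_ge0 ?sumr_ge0//.
  by move=> k _; rewrite divr_ge0.
rewrite addr_ge0 ?divr_ge0 ?mulr_ge0// sumr_ge0// => k _.
by rewrite divr_ge0// mulr_ge0.
Qed.

Local Notation B := ((Psi * Z) * (K.-tuple Psi * K.-tuple Zeta))%type.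

Let mp : measurable_fun setT (fun b : B => b.1.1).
Proof. exact: measurableT_comp. Qed.
Let mz : measurable_fun setT (fun b : B => b.1.2).
Proof. exact: measurableT_comp. Qed.
Let mps : measurable_fun setT (fun b : B => b.2.1).
Proof. exact: measurableT_comp. Qed.
Let mes : measurable_fun setT (fun b : B => b.2.2).
Proof. exact: measurableT_comp. Qed.

Let mqj : measurable_fun setT (fun u : Z * Psi => qpsi u.2 * qz u.2 u.1).
Proof.
apply: measurable_funM; first exact: measurableT_comp.
apply: (measurableT_comp mqz (g := fun u : Z * Psi => (u.2, u.1))).
exact: measurable_fun_pair.
Qed.

Let mzp : measurable_fun setT (fun b : B => (b.1.2, b.1.1)).
Proof. exact: measurable_fun_pair. Qed.

Lemma measurable_block_density : measurable_fun setT block_density.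
Proof.
apply: measurable_funM; last exact: measurable_prod_tnth.
apply: measurable_funM; last exact: measurable_prod_tnth.
exact: (measurableT_comp mqj mzp).
Qed.

Lemma measurable_block_weight : measurable_fun setT block_weight.
Proof.
apply: measurable_fun_divr.
- apply: measurable_funM; first exact: measurableT_comp.
  apply: measurable_funM => //.
  apply: (measurable_sum_tnth _ _ _ _ _ _ _ _
    (fun z e => pj z e / rho z e)) => //.
  exact: measurable_fun_divr.
- apply: measurable_funM => //; apply: measurable_funD.
    apply: measurable_fun_divr; first exact: (measurableT_comp mqj mzp).
    exact: (measurableT_comp mtau mzp).
  apply: (measurable_sum_tnth _ _ _ _ _ _ _ _
    (fun z p => qpsi p * qz p z / tau z p)) => //.
  exact: measurable_fun_divr.
Qed.

Local Open Scope ereal_scope.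

Section iterated_integral.
Variable f : B -> R.
Hypotheses (f0 : forall b, (0 <= f b)%R) (mf : measurable_fun setT f).

Let innerE u :
  \int[sfprod (tuple_measure muP K) (tuple_measure muE K)]_v (f (u, v))%:E =
  \int[tuple_measure muP K]_s \int[tuple_measure muE K]_e (f (u, (s, e)))%:E.
Proof.
rewrite integral_sfprod1//; first by move=> v; rewrite lee_fin.
apply/measurable_EFinP/(measurableT_comp mf); exact: pair1_measurable.
Qed.

Lemma measurable_integral_block : measurable_fun setT (fun u =>
  \int[tuple_measure muP K]_s \int[tuple_measure muE K]_e (f (u, (s, e)))%:E).
Proof.
by under eq_fun do rewrite -innerE; exact: measurable_integral_snd.
Qed.

Lemma integral_block : \int[block_measure]_b (f b)%:E =
  \int[sfprod muP muZ]_u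
    \int[tuple_measure muP K]_s \int[tuple_measure muE K]_e (f (u, (s, e)))%:E.
Proof.
rewrite /block_measure [LHS]integral_sfprod1; first last.
- exact/measurable_EFinP.
- by move=> b; rewrite lee_fin.
by apply: eq_integral => u _; rewrite innerE.
Qed.

End iterated_integral.

Let mtauz z : measurable_fun setT (tau z).
Proof. exact: (measurable_fun_pair2 _ mtau). Qed.
Let mrhoz z : measurable_fun setT (rho z).
Proof. exact: (measurable_fun_pair2 _ mrho). Qed.
Let mpjz z : measurable_fun setT (pj z).
Proof. exact: (measurable_fun_pair2 _ mpj). Qed.
Let mqjz z : measurable_fun setT (fun p => qpsi p * qz p z)%R.
Proof. exact: (measurable_fun_pair2 _ mqj). Qed.

(** Sampling is undone in reverse order: the [zeta_k], the [psi_k], [z] and finally [psi_0] are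
    integrated out, each density contributing 1. *)
Lemma integral_block_density : \int[block_measure]_b (block_density b)%:E = 1.
Proof.
rewrite integral_block; first last.
- exact: measurable_block_density.
- exact: block_density_ge0.
transitivity (\int[sfprod muP muZ]_u (qpsi u.1 * qz u.1 u.2)%:E).
  apply: eq_integral => u _.
  transitivity (\int[tuple_measure muP K]_s
      ((qpsi u.1 * qz u.1 u.2) * \prod_(p <- s) tau u.2 p)%:E).
    apply: eq_integral => s _; rewrite /block_density/= big_tuple.
    under eq_integral => e _.
      rewrite -(big_tuple _ _ e xpredT (rho u.2)) EFinM; over.
    rewrite ge0_integralZl//.
    + by rewrite integral_tuple_prod// mule1.
    + by apply/measurable_EFinP; exact: measurable_tuple_prod.
    + by move=> e _; rewrite lee_fin prodr_ge0.
    + by rewrite lee_fin !mulr_ge0// prodr_ge0.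
  under eq_integral do rewrite EFinM.
  rewrite ge0_integralZl//.
  + by rewrite integral_tuple_prod// mule1.
  + by apply/measurable_EFinP; exact: measurable_tuple_prod.
  + by move=> e _; rewrite lee_fin prodr_ge0.
  + by rewrite lee_fin mulr_ge0.
rewrite integral_sfprod1; first last.
- by apply/measurable_EFinP/measurable_funM => //; exact: measurableT_comp.
- by move=> u; rewrite lee_fin mulr_ge0.
rewrite -[RHS]int_qpsi; apply: eq_integral => p _ /=.
under eq_integral do rewrite EFinM.
rewrite ge0_integralZl ?int_qz ?mule1 ?lee_fin//.
- by apply/measurable_EFinP; exact: (measurable_fun_pair2 _ mqz).
- by move=> z _; rewrite lee_fin.
Qed.

Lemma integral_block_weight_le : (0 < K)%N ->
  (forall z p, tau z p = 0%R -> (qpsi p * qz p z)%R = 0%R) ->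
  \int[block_measure]_b (block_density b * block_weight b)%:E <=
  \int[muZ]_z ((lik z)%:E * \int[muE]_e (pj z e)%:E).
Proof.
move=> K0 tauq.
pose F b := (block_density b * block_weight b)%R.
have F0 b : (0 <= F b)%R.
  by rewrite mulr_ge0 ?block_density_ge0 ?block_weight_ge0.
have mF : measurable_fun setT F.
  by apply: measurable_funM;
    [exact: measurable_block_density|exact: measurable_block_weight].
(* [z] becomes the outermost variable: at fixed [z], [psi_0] and the other [psi_k] can be treated as
   exchangeable. *)
rewrite (integral_block F)// integral_sfprod2; first last.
- exact: measurable_integral_block.
- move=> u; apply: integral_ge0 => s _; apply: integral_ge0 => e _.
  by rewrite lee_fin.
apply: le_integral_pointwise => z.
set pz := \int[muE]_e _.
have pz0 : 0 <= pz by apply: integral_ge0 => e _; rewrite lee_fin.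
(* At fixed [z] the integrand is [lik z * Q * A], where [A] involves only the [zeta_k] and [Q] only
   [psi_0] and the [psi_k]; the two factors are bounded separately by [pz] and 1. *)
pose A (e : K.-tuple Zeta) : R := (\prod_(k < K) rho z (tnth e k) *
  (K%:R^-1 * \sum_(k < K) pj z (tnth e k) / rho z (tnth e k)))%R.
pose Q p (s : K.-tuple Psi) : R := (qpsi p * qz p z *
  \prod_(k < K) tau z (tnth s k) /
  (K.+1%:R^-1 * (qpsi p * qz p z / tau z p + \sum_(k < K)
     qpsi (tnth s k) * qz (tnth s k) z / tau z (tnth s k))))%R.
have FE p s e : F ((p, z), (s, e)) = (lik z * Q p s * A e)%R.
  by rewrite /F /block_density /block_weight /Q /A/=; ring.
have A0 e : (0 <= A e)%R.
  rewrite !mulr_ge0 ?prodr_ge0 ?invr_ge0// sumr_ge0// => k _.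
  by rewrite divr_ge0.
have Q0 p s : (0 <= Q p s)%R.
  rewrite divr_ge0 ?mulr_ge0 ?prodr_ge0 ?invr_ge0//.
  rewrite addr_ge0 ?divr_ge0 ?mulr_ge0//.
  by rewrite sumr_ge0// => k _; rewrite divr_ge0// mulr_ge0.
have mA : measurable_fun setT A.
  apply: measurable_funM.
    under eq_fun do rewrite -(big_tuple _ _ _ xpredT (rho z)).
    exact: measurable_tuple_prod.
  apply: measurable_funM => //.
  under eq_fun do
    rewrite -(big_tuple _ _ _ xpredT (fun e => pj z e / rho z e)%R).
  by apply: measurable_tuple_sum; exact: measurable_fun_divr.
have mQ : measurable_fun setT (fun u : Psi * K.-tuple Psi => Q u.1 u.2).
  apply: measurable_fun_divr.
    apply: measurable_funM.
      exact: (measurableT_comp (mqjz z) measurable_fst).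
    under eq_fun do rewrite -(big_tuple _ _ _ xpredT (tau z)).
    exact: (measurableT_comp (measurable_tuple_prod _ _ _ K _ (mtauz z))
      measurable_snd).
  pose w p := (qpsi p * qz p z / tau z p)%R.
  have mw : measurable_fun setT w by exact: measurable_fun_divr.
  apply: measurable_funM => //; apply: measurable_funD.
    exact: (measurableT_comp mw measurable_fst).
  under eq_fun do rewrite -(big_tuple _ _ _ xpredT w).
  exact: (measurableT_comp (measurable_tuple_sum _ _ _ K _ mw) measurable_snd).
have intA : \int[tuple_measure muE K]_e (A e)%:E <= pz.
  exact: integral_mean_weight_le.
have intQ : \int[muP]_p \int[tuple_measure muP K]_s (Q p s)%:E <= 1.
  by apply: (integral_self_normalized_le _ _ _ muP K
    (fun p => qpsi p * qz p z)%R (tau z)) => // [p|p /tauq//]; rewrite mulr_ge0.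
apply: (@le_trans _ _ (\int[muP]_p \int[tuple_measure muP K]_s
    ((Q p s)%:E * ((lik z)%:E * pz)))).
  apply: le_integral_pointwise => p; apply: le_integral_pointwise => s.
  under eq_integral do rewrite FE EFinM.
  rewrite ge0_integralZl//; first last.
  - by rewrite lee_fin mulr_ge0.
  - by move=> e _; rewrite lee_fin.
  - exact/measurable_EFinP.
  rewrite mulrC EFinM muleA; apply: lee_wpmul2l => //.
  by rewrite mule_ge0 ?lee_fin.
under eq_integral => p _.
  rewrite ge0_integralZr//; first last.
  - by rewrite mule_ge0 ?lee_fin.
  - by move=> s _; rewrite lee_fin.
  - by apply/measurable_EFinP; exact: (measurable_fun_pair2 _ mQ).
  over.
rewrite ge0_integralZr//; first last.
- by rewrite mule_ge0 ?lee_fin.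
- by move=> p _; apply: integral_ge0 => s _; rewrite lee_fin.
- exact: (measurable_integral_snd _ _ _ _ _ (tuple_measure muP K) _ _ mQ).
rewrite -[leRHS]mul1e; apply: lee_wpmul2r => //.
by rewrite mule_ge0 ?lee_fin.
Qed.

End block.

(** * Passage from one block to [M] independent blocks *)

Theorem theorem2 (R : realType)
  (dZ dP dE : measure_display)
  (Z : measurableType dZ) (Psi : measurableType dP) (Zeta : measurableType dE)
  (muZ : {sigma_finite_measure set Z -> \bar R})
  (muP : {sigma_finite_measure set Psi -> \bar R})
  (muE : {sigma_finite_measure set Zeta -> \bar R})
  (M K : nat)
  (lik : Z -> R)              (* z |-> p(x | z), x fixed *)
  (pj : Z -> Zeta -> R)       (* (z, zeta) |-> p(z, zeta) *)
  (qpsi : Psi -> R)           (* psi |-> q(psi | x) *)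
  (qz : Psi -> Z -> R)        (* (psi, z) |-> q(z | psi, x) *)
  (tau : Z -> Psi -> R)       (* (z, psi) |-> tau(psi | z, x) *)
  (rho : Z -> Zeta -> R)      (* (z, zeta) |-> rho(zeta | z) *)
  :
  (0 < M)%N -> (0 < K)%N ->
  (* p(x | z) : nonnegative measurable in z *)
  (forall z, 0 <= lik z) -> measurable_fun setT lik ->
  (* p(z, zeta) : a joint density *)
  (forall z e, 0 <= pj z e) ->
  measurable_fun setT (fun u : Z * Zeta => pj u.1 u.2) ->
  (\int[(muZ \x muE)%E]_u (pj u.1 u.2)%:E = 1)%E ->
  (* q(psi | x) : a density *)
  (forall p, 0 <= qpsi p) -> measurable_fun setT qpsi ->
  (\int[muP]_p (qpsi p)%:E = 1)%E ->
  (* q(z | psi, x) : a conditional density in z *)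
  (forall p z, 0 <= qz p z) ->
  measurable_fun setT (fun u : Psi * Z => qz u.1 u.2) ->
  (forall p, \int[muZ]_z (qz p z)%:E = 1)%E ->
  (* tau(psi | z, x) : a conditional density in psi *)
  (forall z p, 0 <= tau z p) ->
  measurable_fun setT (fun u : Z * Psi => tau u.1 u.2) ->
  (forall z, \int[muP]_p (tau z p)%:E = 1)%E ->
  (* tau(psi | z, x) = 0 implies q(z, psi | x) = 0 *)
  (forall z p, tau z p = 0 -> qpsi p * qz p z = 0) ->
  (* rho(zeta | z) : a conditional density in zeta *)
  (forall z e, 0 <= rho z e) ->
  measurable_fun setT (fun u : Z * Zeta => rho u.1 u.2) ->
  (forall z, \int[muE]_e (rho z e)%:E = 1)%E ->
  let qj (z : Z) (p : Psi) : R := qpsi p * qz p z in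
  (* p(x) = \int p(x|z) p(z) dz with p(z) = \int p(z, zeta) dzeta *)
  let px : \bar R :=
    (\int[muZ]_z ((lik z)%:E * \int[muE]_e (pj z e)%:E))%E in
  (* one block m of the generative process:
     ((psi_{m,0}, z_m), ((psi_{m,k})_{k<K}, (zeta_{m,k})_{k<K})) *)
  let blockmeas :=
    ((muP \x muZ) \x (tuple_measure muP K \x tuple_measure muE K))%E in
  let blockdens (b : (Psi * Z) * (K.-tuple Psi * K.-tuple Zeta)) : R :=
    qpsi b.1.1 * qz b.1.1 b.1.2
    * (\prod_(k < K) tau b.1.2 (tnth b.2.1 k))
    * (\prod_(k < K) rho b.1.2 (tnth b.2.2 k)) in
  (* the importance weight inside the logarithm *)
  let blockw (b : (Psi * Z) * (K.-tuple Psi * K.-tuple Zeta)) : R :=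
    let z := b.1.2 in
    (lik z * (K%:R^-1 * \sum_(k < K)
                 pj z (tnth b.2.2 k) / rho z (tnth b.2.2 k)))
    / ((K.+1)%:R^-1 * (qj z b.1.1 / tau z b.1.1
                       + \sum_(k < K) qj z (tnth b.2.1 k) / tau z (tnth b.2.1 k))) in
  let W (w : M.-tuple ((Psi * Z) * (K.-tuple Psi * K.-tuple Zeta))) : R :=
    M%:R^-1 * \sum_(m < M) blockw (tnth w m) in
  (* expectation over the generative process: the M blocks are independent,
     each with density blockdens w.r.t. blockmeas *)
  (\int[tuple_measure blockmeas M]_w
      ((\prod_(m < M) blockdens (tnth w m))%:E * lne (W w)%:E)
   <= lne px)%E.
Proof.
move=> M0 K0 lik0 mlik pj0 mpj int_pj qpsi0 mqpsi int_qpsi qz0 mqz int_qz.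
move=> tau0 mtau int_tau tauq rho0 mrho int_rho; cbv zeta.
pose m := block_measure _ _ _ _ Z Psi Zeta muZ muP muE K.
pose D := block_density _ _ _ _ Z Psi Zeta K qpsi qz tau rho.
pose w := block_weight _ _ _ _ Z Psi Zeta K lik pj qpsi qz tau rho.
(* The bare product measure of the statement is convertible to [m], which carries the sigma-finite
   structure. *)
change (\int[tuple_measure m M]_u ((\prod_(i < M) D (tnth u i))%:E *
    lne (M%:R^-1 * \sum_(i < M) w (tnth u i))%:E) <=
  lne (\int[muZ]_z ((lik z)%:E * \int[muE]_e (pj z e)%:E)))%E.
set px := (\int[muZ]_z _)%E.
have D0 b : 0 <= D b by exact: block_density_ge0.
have mD : measurable_fun setT D by exact: measurable_block_density.
have w0 b : 0 <= w b by exact: block_weight_ge0.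
have mw : measurable_fun setT w by exact: measurable_block_weight.
have intD : (\int[m]_b (D b)%:E = 1)%E.
  exact: integral_block_density.
have intDw : (\int[m]_b (w b * D b)%:E <= px)%E.
  under eq_integral do rewrite mulrC.
  exact: integral_block_weight_le.
under eq_integral => u _.
  rewrite -(big_tuple _ _ u xpredT D) -(big_tuple _ _ u xpredT w); over.
apply: integral_density_lne_le.
- exact: measurable_tuple_prod.
- by apply: measurable_funM => //; exact: measurable_tuple_sum.
- by move=> u; rewrite prodr_ge0.
- by move=> u; rewrite mulr_ge0 ?invr_ge0 ?sumr_ge0.
- exact: integral_tuple_prod.
(* What remains is that the mean weight has expectation at most [px]: the [M] blocks contribute
   equally, and [M] cancels against the factor of the mean. *)
under eq_integral do rewrite mulrC -mulrA EFinM.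
rewrite ge0_integralZl//; first last.
- by move=> u _; rewrite lee_fin mulr_ge0 ?sumr_ge0 ?prodr_ge0.
- apply/measurable_EFinP/measurable_funM; first exact: measurable_tuple_sum.
  exact: measurable_tuple_prod.
rewrite integral_tuple_sum_prod// muleA -EFinM mulVf ?pnatr_eq0 -?lt0n//.
by rewrite mul1e.
Qed.
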